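(* Let $d$ be a nonnegative integer and let $$H_1(x)=\sum_{i=1}^k \alpha_i (x+x_i)^d,$$ where $x_1,\ldots,x_k$ are distinct real constants, the $\alpha_i$ are nonzero real constants, and $k \leq (d+2)/4$. If $H_1$ is written in the form $$H_1(x)=\sum_{i=1}^l \beta_i (x+y_i)^{e_i}$$ with real constants $\beta_i,y_i$ and arbitrary nonnegative integers $e_i$ (not bounded by $d$), then $l \geq k$. *)

(* Defs.v *)
From mathcomp Require Export all_boot all_order all_algebra.
From mathcomp Require Export reals.

Set Implicit Arguments.
Unset Strict Implicit.
Unset Printing Implicit Defensive.

(* Main.v *)
Require Import Defs.
From mathcomp Require Import all_boot all_order all_algebra reals.
From mathcomp Require Import polyrcf zify.
Import Order.TTheory GRing.Theory Num.Theory.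
Local Open Scope ring_scope.

Set Implicit Arguments.
Unset Strict Implicit.
Unset Printing Implicit Defensive.

(** Write a polynomial identity between shifted powers as
    [\sum_i c_i (X - t_i)^(e_i) = 0].  The truncated sum
    [f x = \sum_(t_i <= x) c_i (x - t_i)^(e_i)] then has bounded support, so by
    Rolle each differentiation adds one sign alternation, except that every
    jump of the function being differentiated costs at most two.  The [j]-th
    derivative jumps only at the [t_i] with [e_i = j].  Let [j0] be the largest
    [j] with [j <= 2 * #{i | e_i < j}]; the hypothesis [4 k <= d + 2] gives
    [j0 <= d] when [l < k].  From [j0] on the alternations are gained faster
    than they are lost, although a high enough derivative is identically zero;
    hence the [j0]-th derivative of [f] already vanishes.  Comparing the
    coefficients of [(X - t)^(d - j0)] at each knot [t], every [x_i] must occur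
    among the [y_i], which contradicts [l < k]. *)

(** * Auxiliary facts on roots and derivatives of polynomials *)

Lemma poly_eq0_on_itv (R : realFieldType) (p : {poly R}) (a b : R) :
  a < b -> (forall x, a < x < b -> p.[x] = 0) -> p = 0.
Proof.
move=> ab p0.
(* Denominators from 2 on keep these roots strictly below [b]. *)
pose g i := a + (b - a) / i.+2%:R.
apply: (@roots_geq_poly_eq0 _ _ (mkseq g (size p))); last by rewrite size_mkseq.
- apply/allP => _ /mapP[i _ ->]; apply/rootP/p0.
  rewrite ltrDl divr_gt0 ?subr_gt0 ?ltr0n //= -ltrBrDl.
  by rewrite ltr_pdivrMr ?ltr0n // ltr_pMr ?subr_gt0 // ltr1n.
- apply/mkseq_uniqP => i j _ _ /addrI /(mulfI _) h.
  have /invr_inj/eqP : (i.+2%:R : R)^-1 = j.+2%:R^-1.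
    by apply: h; rewrite subr_eq0 gt_eqF.
  by rewrite eqr_nat => /eqP[].
Qed.

Lemma derivn_expXsubC (R : comNzRingType) (a : R) (n j : nat) :
  (('X - a%:P) ^+ n)^`(j) = ('X - a%:P) ^+ (n - j) *+ n ^_ j.
Proof.
elim: j => [|j IHj]; first by rewrite derivn0 subn0 ffactn0.
rewrite derivnS IHj derivMn deriv_exp derivXsubC mul1r -mulrnA.
by rewrite -subnS mulnC ffactnSr.
Qed.

Lemma horner_derivn_expXsubC (R : comNzRingType) (a : R) (n j : nat) :
  (('X - a%:P) ^+ n)^`(j).[a] = (if n == j then j`! else 0)%:R.
Proof.
rewrite derivn_expXsubC hornerMn horner_exp hornerXsubC subrr expr0n subn_eq0.
case: ltngtP => [nj|jn|->]; last by rewrite ffactnn.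
- by rewrite ffact_small // mulr0n.
- by rewrite mul0rn.
Qed.

(** * Sign alternations *)

Section Alternation.

Variable R : realFieldType.
Implicit Types (f : R -> R) (s a : R) (n : nat).

(** Only the sign of [s] matters. The weak [a <= x] suffices, since consecutive values have opposite
    signs and so sit at distinct points. *)
Fixpoint alternates f s n a : Prop :=
  if n is n'.+1 then
    exists x, [/\ a <= x, 0 < s * f x & alternates f (- s) n' x]
  else True.

Lemma alternates_le_start f s n a a' :
  a' <= a -> alternates f s n a -> alternates f s n a'.
Proof.
case: n => //= n a'a [x [ax fx alt]].
by exists x; split=> //; apply: le_trans a'a ax.
Qed.

Lemma alternates_leq f s n m a :
  (m <= n)%N -> alternates f s n a -> alternates f s m a.
Proof.
elim: n s m a => [|n IHn] s [|m] a //= mn [x [ax fx alt]].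
by exists x; split=> //; apply: IHn alt.
Qed.

Lemma alternates_behead f s n a :
  alternates f s n a -> alternates f (- s) n.-1 a.
Proof.
by case: n => //= n [x [ax _ alt]]; apply: alternates_le_start alt.
Qed.

End Alternation.

(** * Truncated sums and Rolle's theorem *)

Section TruncatedSum.

Variables (R : rcfType) (I : finType) (t : I -> R).
Implicit Types (q : I -> {poly R}) (s u v x : R).

Definition trunc_sum q x := \sum_(i | t i <= x) (q i).[x].

(** Indices rather than points: terms sharing a knot may cancel, so this only bounds the
    discontinuities from above. A knot at [u] is left out, its term being already part of the value
    at [u]. *)
Definition jumps q u := [pred i | (u < t i) && ((q i).[t i] != 0)].

Lemma trunc_sumE q u x :
  (forall i, u < t i -> t i <= x -> (q i).[x] = 0) -> u <= x ->
  trunc_sum q x = (\sum_(i | t i <= u) q i).[x].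
Proof.
move=> q0 ux; rewrite /trunc_sum horner_sum (bigID (fun i => t i <= u)) /=.
rewrite [X in _ + X]big1 ?addr0 => [|i /andP[tx /negP]]; last first.
  by move/negP; rewrite -ltNge => /q0; apply.
apply: eq_bigl => i; apply: andb_idl => /le_trans; exact.
Qed.

(** The function is continuous on the interval. Split at an interior knot: it still rises on one of
    the two pieces. Without interior knots it is a single polynomial, and the mean value theorem
    applies. *)
Lemma trunc_sum_mvt q s u v :
  u <= v -> (forall i, u < t i -> t i <= v -> (q i).[t i] = 0) ->
  s * trunc_sum q u < s * trunc_sum q v ->
  exists c, [/\ u <= c, c <= v & 0 < s * trunc_sum (fun i => (q i)^`()) c].
Proof.
have [n] := ubnP #|[pred i | u < t i < v]|.
elim: n u v => // n IHn u v card_knots uv q0 quv.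
have {}uv : u < v.
  by rewrite lt_neqAle uv andbT; apply: contraTneq quv => ->; rewrite ltxx.
case: (pickP [pred i | u < t i < v]) => [k /= /andP[uk kv]|no_knot].
- have [lt_uk|le_ku] := ltP (s * trunc_sum q u) (s * trunc_sum q (t k)).
  + have [||||c [uc cv c0]] := IHn u (t k); rewrite ?(ltW uk) //.
    * rewrite -ltnS; apply: leq_trans card_knots; rewrite ltnS.
      apply/proper_card/properP; split.
        by apply/subsetP=> i; rewrite !inE => /andP[-> /lt_trans->].
      by exists k; rewrite !inE ?uk ?kv ?ltxx ?andbF.
    * by move=> i ui ik; apply: q0 => //; apply: le_trans ik (ltW kv).
    * by exists c; split=> //; apply: le_trans cv (ltW kv).
  + have [||||c [uc cv c0]] := IHn (t k) v; rewrite ?(ltW kv) //.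
    * rewrite -ltnS; apply: leq_trans card_knots; rewrite ltnS.
      apply/proper_card/properP; split.
        by apply/subsetP=> i; rewrite !inE => /andP[/(lt_trans uk)-> ->].
      by exists k; rewrite !inE ?uk ?kv ?ltxx.
    * by move=> i ki; apply: q0 => //; apply: lt_trans uk ki.
    * exact: le_lt_trans le_ku quv.
    * by exists c; split=> //; apply: le_trans (ltW uk) uc.
- pose p := \sum_(i | t i <= u) q i.
  have tv i : u < t i -> t i <= v -> t i = v.
    move=> ui; rewrite le_eqVlt => /predU1P[//|iv].
    by have := no_knot i; rewrite /= ui iv.
  have pv : trunc_sum q v = p.[v].
    by apply: trunc_sumE (ltW uv) => // i ui iv; rewrite -(tv i) ?q0.
  have pu : trunc_sum q u = p.[u].
    by apply: trunc_sumE => // i ui; rewrite leNgt ui.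
  have [c /itvP cuv pc] := poly_mvt p uv.
  exists c; split; rewrite ?cuv //.
  rewrite (@trunc_sumE _ u) ?cuv // => [|i ui ic].
    rewrite -raddf_sum -/p -(pmulr_lgt0 _ (_ : 0 < v - u)) ?subr_gt0 //.
    by rewrite -mulrA -pc mulrBr subr_gt0 -pu -pv.
  by have := no_knot i; rewrite /= ui (le_lt_trans ic) ?cuv.
Qed.

Lemma trunc_sum_eventually0 q x :
  \sum_i q i = 0 -> exists2 y, x <= y & trunc_sum q y = 0.
Proof.
move=> q0; exists (\big[Order.max/x]_i t i); first exact: bigmax_ge_id.
rewrite /trunc_sum (eq_bigl xpredT) => [|i]; last exact: le_bigmax.
by rewrite -horner_sum q0 horner0.
Qed.

(* Each jump destroys at most one of the n.+1 monotone stretches, hence at most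
   two of the alternations of the derivative. *)
Lemma alternates_deriv q s n u :
  \sum_i q i = 0 ->
  s * trunc_sum q u < 0 \/ s * trunc_sum q u <= 0 /\ (0 < n)%N ->
  alternates (trunc_sum q) s n u ->
  alternates (trunc_sum (fun i => (q i)^`())) s (n.+1 - 2 * #|jumps q u|) u.
Proof.
move=> q0; elim: n s u => [|n IHn] s u.
  (* With no alternation given, the rise is from the strictly negative value at [u] to 0 beyond all
     knots. *)
  case=> [su _|[]//]; case: (pickP (jumps q u)) => [k uk|no_jump].
    have card_gt0 : (0 < #|jumps q u|)%N by apply/card_gt0P; exists k.
    by rewrite (_ : _ - _ = 0)%N //; lia.
  rewrite eq_card0 // muln0 /=.
  have [y uy y0] := trunc_sum_eventually0 u q0.
  have [//|||c [uc _ c0]] := @trunc_sum_mvt q s u y; last by exists c.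
  - move=> i ui _; apply/eqP; have := no_jump i.
    by rewrite /= ui /= => /negbFE.
  - by rewrite y0 mulr0.
move=> su [x [ux sx alt]].
have {}su : s * trunc_sum q u <= 0 by case: su => [/ltW|[]].
have nsx : - s * trunc_sum q x < 0 by rewrite mulNr oppr_lt0.
have {}alt := IHn _ _ (or_introl nsx) alt.
(* A jump before [x] spoils the rise from [u] to [x]. Dropping the first alternation after [x]
   restores the sign [s]; the two lost are paid for by that jump. *)
case: (pickP [pred i | jumps q u i && (t i <= x)]) => [k /= /andP[uk kx]|no_jump].
- have card_lt : (#|jumps q x| < #|jumps q u|)%N.
    apply/proper_card/properP; split.
      apply/subsetP => i; rewrite !inE => /andP[xi ->].
      by rewrite (le_lt_trans ux xi).
    by exists k; rewrite // inE ltNge kx.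
  apply: alternates_le_start ux _.
  have := alternates_behead alt; rewrite opprK; apply: alternates_leq; lia.
- have card_le : (#|jumps q x| <= #|jumps q u|)%N.
    apply/subset_leq_card/subsetP => i; rewrite !inE => /andP[xi ->].
    by rewrite (le_lt_trans ux xi).
  have [//|||c [uc cx c0]] := @trunc_sum_mvt q s u x.
  + move=> i ui ix; apply/eqP; have := no_jump i.
    by rewrite /= ui ix /= andbT => /negbFE.
  + exact: le_lt_trans su sx.
  apply: (@alternates_leq _ _ _ (n.+1 - 2 * #|jumps q x|).+1); first lia.
  by exists c; split=> //; apply: alternates_le_start cx alt.
Qed.

(** The polynomials valid just right and just left of [u] both vanish; their difference is this
    sum. *)
Lemma trunc_sum_eq0_at q u :
  (forall x, trunc_sum q x = 0) -> \sum_(i | t i == u) q i = 0.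
Proof.
move=> q0.
pose v := \big[Order.min/u + 1]_(i | u < t i) t i.
pose w := \big[Order.max/u - 1]_(i | t i < u) t i.
have uv : u < v by apply: lt_bigmin; rewrite ?ltrDl.
have wu : w < u by apply: bigmax_lt; rewrite ?gtrBl.
have tv i : t i < v -> t i <= u.
  move=> iv; rewrite leNgt; apply: contraTN iv => ui.
  by rewrite -leNgt; apply: (@bigmin_le_cond _ R _ _ i (fun i => u < t i)).
have tw i : t i < u -> t i <= w.
  exact: (@le_bigmax_cond _ R _ _ i (fun i => t i < u)).
have le0 : \sum_(i | t i <= u) q i = 0.
  apply: (poly_eq0_on_itv uv) => x /andP[ux xv].
  rewrite -trunc_sumE ?ltW // => i ui ix.
  by have := tv i (le_lt_trans ix xv); rewrite leNgt ui.
have lt0 : \sum_(i | t i < u) q i = 0.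
  apply: (poly_eq0_on_itv wu) => x /andP[wx xu].
  rewrite (eq_bigl (fun i => t i <= w)) => [|i]; last first.
    by apply/idP/idP => [/tw //|iw]; apply: le_lt_trans iw wu.
  rewrite -trunc_sumE ?ltW // => i wi ix.
  by have := tw i (le_lt_trans ix xu); rewrite leNgt wi.
move: le0; rewrite (bigID (fun i => t i == u)) /= [X in _ + X](_ : _ = 0).
  rewrite addr0 => eq0; rewrite -[RHS]eq0; apply: eq_bigl => i.
  by rewrite andb_idl // => /eqP->.
by rewrite -[RHS]lt0; apply: eq_bigl => i; rewrite lt_neqAle andbC.
Qed.

End TruncatedSum.

(** * Truncated sums of shifted powers *)

Section PowerSums.

Variables (R : rcfType) (I : finType) (c t : I -> R) (e : I -> nat).

Let q i := c i *: ('X - (t i)%:P) ^+ e i.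

Let ndeg j := #|[pred i | (e i < j)%N]|.

(** Stated as an increment of [ndeg] so that the losses telescope over successive derivatives. *)
Lemma card_jumps_derivn j u :
  (#|jumps t (fun i => (q i)^`(j)) u| <= ndeg j.+1 - ndeg j)%N.
Proof.
have -> : ndeg j.+1 = (ndeg j + #|[pred i | e i == j]|)%N.
  rewrite -cardUI [X in (_ + X)%N]eq_card0 ?addn0 => [|i].
    by apply: eq_card => i; rewrite !inE ltnS leq_eqVlt orbC.
  by rewrite !inE; case: ltngtP.
rewrite addKn; apply/subset_leq_card/subsetP => i; rewrite !inE => /andP[_].
rewrite /q derivnZ hornerZ horner_derivn_expXsubC.
by case: (e i == j); rewrite ?mulr0 ?eqxx.
Qed.

Lemma trunc_sum_derivn_eq0 j0 :
  \sum_i q i = 0 ->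
  (forall j, (j0 < j)%N -> (2 * ndeg j < 2 * ndeg j0 + (j - j0))%N) ->
  forall x, trunc_sum t (fun i => (q i)^`(j0)) x = 0.
Proof.
move=> q0 few x; apply/eqP; apply: contraT => fx.
pose f j := trunc_sum t (fun i => (q i)^`(j)).
(* A start left of [x] and of all knots, where every derivative is 0. *)
pose a := \big[Order.min/x]_i t i - 1.
have ax : a <= x by rewrite lerBlDr (le_trans (bigmin_le_id _ _ _ _)) ?lerDl.
have at_ i : a < t i.
  by rewrite ltrBlDr; apply: le_lt_trans (bigmin_le _ i _) _; rewrite ltrDl.
have fa j : f j a = 0.
  by apply: big1 => i; rewrite leNgt at_.
have sum0 j : \sum_i (q i)^`(j) = 0 by rewrite -raddf_sum q0 raddf0.
have alt m : alternates (f (j0 + m)%N) (f j0 x)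
    (m.+1 - 2 * (ndeg (j0 + m) - ndeg j0)) a.
  elim: m => [|m IHm].
    rewrite addn0 subnn muln0 /=; exists x; split=> //.
    by rewrite lt0r mulf_neq0 //= -expr2 sqr_ge0.
  have ndeg_mono j j' : (j <= j')%N -> (ndeg j <= ndeg j')%N.
    move=> jj'; apply/subset_leq_card/subsetP => i; rewrite !inE.
    by move/leq_trans; apply.
  have le0 := ndeg_mono _ _ (leq_addr m j0).
  have le1 := ndeg_mono _ _ (leqnSn (j0 + m)).
  (* The value at [a] is 0, not strictly negative, so the next Rolle step requires an alternation to
     be left. *)
  have n_gt0 : (0 < m.+1 - 2 * (ndeg (j0 + m) - ndeg j0))%N.
    case: m {IHm} le0 le1 => [|m] _ _; first by rewrite addn0 subnn.
    by have := few (j0 + m.+1)%N; lia.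
  have := alternates_deriv (sum0 (j0 + m)%N) (or_intror (conj _ n_gt0)) IHm.
  rewrite -/(f _) fa mulr0 lexx => /(_ isT).
  rewrite addnS; apply: alternates_leq.
  have := card_jumps_derivn (j0 + m) a; lia.
pose m := (\max_i e i).+1.
have f0 y : f (j0 + m)%N y = 0.
  apply: big1 => i _; rewrite /q derivnZ derivn_expXsubC ffact_small.
    by rewrite mulr0n scaler0 horner0.
  by rewrite ltn_addl // ltnS leq_bigmax.
have /few few_m : (j0 < j0 + m)%N by rewrite addnS ltnS leq_addr.
have n_gt0 : (0 < m.+1 - 2 * (ndeg (j0 + m) - ndeg j0))%N by lia.
move: (alt m) n_gt0; case: (_ - _)%N => // n [y [_]].
by rewrite f0 mulr0 ltxx.
Qed.

End PowerSums.

Theorem theorem16 (R : realType) (d k l : nat)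
    (alpha x : 'I_k -> R) (beta y : 'I_l -> R) (e : 'I_l -> nat)
    (x_inj : injective x)
    (alpha_neq0 : forall i, alpha i != 0)
    (k_le : (4 * k <= d + 2)%N)
    (H1_eq : \sum_(i < k) alpha i *: ('X + (x i)%:P) ^+ d =
             \sum_(i < l) beta i *: ('X + (y i)%:P) ^+ (e i)) :
  (k <= l)%N.
Proof.
rewrite leqNgt; apply/negP => lt_lk.
pose I : finType := ('I_k + 'I_l)%type.
pose c (i : I) := match i with inl i => alpha i | inr i => - beta i end.
pose t (i : I) := match i with inl i => - x i | inr i => - y i end.
pose E (i : I) := match i with inl _ => d | inr i => e i end.
pose q i := c i *: ('X - (t i)%:P) ^+ E i.
pose ndeg j := #|[pred i | (E i < j)%N]|.
have q0 : \sum_i q i = 0.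
  rewrite big_sumType /= /q /=; apply/eqP; rewrite addr_eq0 -sumrN; apply/eqP.
  under eq_bigr do rewrite polyCN opprK.
  by rewrite H1_eq; apply: eq_bigr => i _; rewrite polyCN opprK scaleNr opprK.
have ndeg_le j : (2 * ndeg j <= d)%N.
  (* There are [k + l <= 2 * k - 1] terms, and [2 * (2 * k - 1) <= d] is exactly [k_le]. *)
  have : (ndeg j <= #|I|)%N by apply: max_card.
  rewrite card_sum !card_ord; lia.
have ex_j0 : exists j, (j <= 2 * ndeg j)%N by exists 0%N.
have ub_j0 j : (j <= 2 * ndeg j)%N -> (j <= d)%N by move/leq_trans; apply.
have [j0 j0_le j0_max] := ex_maxnP ex_j0 ub_j0.
have f0 : forall z, trunc_sum t (fun i => (q i)^`(j0)) z = 0.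
  apply: trunc_sum_derivn_eq0 => // j lt_j.
  (* By maximality [2 * ndeg j < j], while [j0 <= 2 * ndeg j0]. *)
  have : ~~ (j <= 2 * ndeg j)%N by apply/negP => /j0_max; lia.
  rewrite -/(ndeg j) -/(ndeg j0); lia.
have derivn_d (p : {poly R}) : (p^`(j0))^`(d - j0) = p^`(d).
  by rewrite /derivn -iterD subnK // ub_j0.
have match_x i : exists i', (y i' == x i) && (e i' == d).
  apply/existsP; apply: contraT; rewrite negb_exists => /forallP no_match.
  (* At this knot only terms of exponent [d] survive; without a match that is [inl i] alone, leaving
     [alpha i * d! = 0]. *)
  have := congr1 (fun p => (p^`(d - j0)).[- x i]) (trunc_sum_eq0_at (- x i) f0).
  rewrite /= raddf_sum horner_sum raddf0 horner0 (bigD1 (inl i)) //= big1.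
    rewrite addr0 derivn_d /q derivnZ hornerZ.
    rewrite horner_derivn_expXsubC eqxx => /eqP.
    by rewrite mulf_eq0 (negPf (alpha_neq0 i)) pnatr_eq0 -leqn0 leqNgt fact_gt0.
  move=> j /andP[/eqP tj ji].
  rewrite derivn_d /q derivnZ hornerZ -tj.
  rewrite horner_derivn_expXsubC.
  case: j tj ji => j /= /oppr_inj; first by move/x_inj->; rewrite eqxx.
  move=> yj _; have := no_match j; rewrite yj eqxx /= => /negPf->.
  by rewrite mulr0.
pose phi i := xchoose (match_x i).
have y_phi i : y (phi i) = x i by have /andP[/eqP] := xchooseP (match_x i).
have phi_inj : injective phi.
  by move=> i i' eq_phi; apply: x_inj; rewrite -!y_phi eq_phi.
by have := leq_card phi phi_inj; rewrite !card_ord leqNgt lt_lk.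
Qed.
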